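(* Over $\mathrm{RCA}_0^*$, each of the principles $\ell\text{-}\mathrm{RT}^2_2$, $\ell\text{-}\mathrm{CAC}$, $\ell\text{-}\mathrm{ADS}^{\mathrm{st}}$ implies $\mathrm{I}\Sigma^0_1$.
   Context: $\mathrm{RCA}_0^*$ is $\mathrm{RCA}_0$ with $\Sigma^0_1$-induction replaced by $\Delta^0_0$-induction plus the axiom $\exp$; $\mathrm{I}\Sigma^0_1$ is the $\Sigma^0_1$-induction scheme. A set $S\subseteq\mathbb{N}$ has cardinality $\mathbb{N}$ if for every $n$ it contains a finite subset with $n$ elements. $\ell\text{-}\mathrm{RT}^2_2$: for every $c\colon[\mathbb{N}]^2\to2$ there is a set $H$ of cardinality $\mathbb{N}$ with $c\restriction[H]^2$ constant. $\ell\text{-}\mathrm{CAC}$: every partial order $(\mathbb{N},\preceq)$ has a chain or antichain of cardinality $\mathbb{N}$. $\ell\text{-}\mathrm{ADS}^{\mathrm{st}}$: for every linear order $(\mathbb{N},\preceq)$ there is a set $S$ of cardinality $\mathbb{N}$ such that either for all $x,y\in S$, $x\le y\iff x\preceq y$, or for all $x,y\in S$, $x\le y\iff x\succeq y$. *)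

(* Defs.v *)
(** Second-order arithmetic is treated through its (Henkin) structures: a
    principle is a property of structures for the two-sorted language
    0, 1, +, *, <, ∈, and "P implies Q over T" means that every structure that
    satisfies T and P satisfies Q.  By completeness this is provability in the
    two-sorted first-order logic of the language. *)

Set Implicit Arguments.

Record L2_structure : Type := {
  num   : Type;
  nset  : Type;
  zero  : num;
  one   : num;
  add   : num -> num -> num;
  mul   : num -> num -> num;
  lt    : num -> num -> Prop;
  mem   : num -> nset -> Prop }.

(** ** Bounded formulas *)

(** Number variables are de Bruijn indices.  Set variables are never bound in
    a bounded formula, so they are plain names. *)
Inductive term : Type :=
| tvar  : nat -> term
| tzero : term
| tone  : term
| tadd  : term -> term -> term
| tmul  : term -> term -> term.

(** In [ball t p] (for all x < t, p) and [bex t p] the term [t] lies outside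
    the scope of the quantifier, so the bound does not mention x. *)
Inductive Delta00 : Type :=
| feq   : term -> term -> Delta00
| flt   : term -> term -> Delta00
| fmem  : term -> nat -> Delta00
| fnot  : Delta00 -> Delta00
| fand  : Delta00 -> Delta00 -> Delta00
| for_  : Delta00 -> Delta00 -> Delta00
| fimp  : Delta00 -> Delta00 -> Delta00
| ball  : term -> Delta00 -> Delta00
| bex   : term -> Delta00 -> Delta00.

Definition scons (T : Type) (x : T) (e : nat -> T) (i : nat) : T :=
  match i with
  | O => x
  | S j => e j
  end.

Section Structure.

Variable M : L2_structure.

Local Notation "0" := (zero M).
Local Notation "1" := (one M).
Local Notation "x + y" := (add M x y).
Local Notation "x * y" := (mul M x y).
Local Notation "x < y" := (lt M x y).
Local Notation "x ∈ A" := (mem M x A) (at level 70).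

Fixpoint eval (e : nat -> num M) (t : term) : num M :=
  match t with
  | tvar i => e i
  | tzero => 0
  | tone => 1
  | tadd t u => eval e t + eval e u
  | tmul t u => eval e t * eval e u
  end.

Fixpoint sat (E : nat -> nset M) (e : nat -> num M) (p : Delta00) : Prop :=
  match p with
  | feq t u => eval e t = eval e u
  | flt t u => eval e t < eval e u
  | fmem t X => eval e t ∈ E X
  | fnot q => ~ sat E e q
  | fand q r => sat E e q /\ sat E e r
  | for_ q r => sat E e q \/ sat E e r
  | fimp q r => sat E e q -> sat E e r
  | ball t q => forall x, x < eval e t -> sat E (scons x e) q
  | bex t q => exists x, x < eval e t /\ sat E (scons x e) q
  end.

(** The subsets of [num M] defined, with parameters [e] and [E], by the formula
    [p] itself, by the Σ⁰₁ formula ∃y p and by the Π⁰₁ formula ∀y p.  In the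
    last two, variable 0 of [p] is y and variable 1 is the argument [n]. *)
Definition def_Delta00 (p : Delta00) E e (n : num M) : Prop :=
  sat E (scons n e) p.
Definition def_Sigma01 (p : Delta00) E e (n : num M) : Prop :=
  exists y, sat E (scons y (scons n e)) p.
Definition def_Pi01 (p : Delta00) E e (n : num M) : Prop :=
  forall y, sat E (scons y (scons n e)) p.

(** ** Finite sets, functions and relations inside the structure *)

Definition le (x y : num M) : Prop := x < y \/ x = y.

Definition pair (i j : num M) : num M := (i + j) * (i + j) + i.

Definition full (x : num M) : Prop := True.

Definition times (A B : num M -> Prop) (p : num M) : Prop :=
  exists i j, A i /\ B j /\ p = pair i j.

(** The set [f] is (the graph of) a function from [A] to [B]. *)
Definition is_function (f : nset M) (A B : num M -> Prop) : Prop :=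
  (forall p, p ∈ f -> times A B p) /\
  (forall i, A i -> exists! j, pair i j ∈ f).

Definition is_bijection (f : nset M) (A B : num M -> Prop) : Prop :=
  is_function f A B /\
  (forall i i' j, pair i j ∈ f -> pair i' j ∈ f -> i = i') /\
  (forall j, B j -> exists i, pair i j ∈ f).

Definition finite_set (F : nset M) : Prop :=
  exists b, forall x, x ∈ F -> x < b.

Definition has_n_elements (F : nset M) (n : num M) : Prop :=
  exists f : nset M, is_bijection f (fun i => i < n) (fun x => x ∈ F).

(** [n] ranges over all the numbers of the structure, standard or not. *)
Definition cardinality_N (A : nset M) : Prop :=
  forall n, exists F : nset M,
    (forall x, x ∈ F -> x ∈ A) /\ finite_set F /\ has_n_elements F n.

(** ** Axioms *)

Definition basic_axioms : Prop :=
  (forall n, n + 1 <> 0) /\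
  (forall m n, m + 1 = n + 1 -> m = n) /\
  (forall m, m + 0 = m) /\
  (forall m n, m + (n + 1) = (m + n) + 1) /\
  (forall m, m * 0 = 0) /\
  (forall m n, m * (n + 1) = m * n + m) /\
  (forall m, ~ m < 0) /\
  (forall m n, m < n + 1 <-> m < n \/ m = n).

Definition induction_for (P : num M -> Prop) : Prop :=
  P 0 -> (forall n, P n -> P (n + 1)) -> forall n, P n.

Definition IDelta00 : Prop :=
  forall p E e, induction_for (def_Delta00 p E e).

Definition ISigma01 : Prop :=
  forall p E e, induction_for (def_Sigma01 p E e).

Definition Delta01_comprehension : Prop :=
  forall p q E e,
    (forall n, def_Sigma01 p E e n <-> def_Pi01 q E e n) ->
    exists A : nset M, forall n, n ∈ A <-> def_Sigma01 p E e n.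

(** y = 2^n, witnessed by the sequence of values 2^0, ..., 2^n.  The sequence
    has to be total on {i : i <= n}: without Σ⁰₁-induction this would not
    follow from the recursion equations. *)
Definition is_pow2 (n y : num M) : Prop :=
  exists f : nset M,
    is_function f (fun i => le i n) full /\
    pair 0 1 ∈ f /\
    (forall i v, i < n -> pair i v ∈ f -> pair (i + 1) ((1 + 1) * v) ∈ f) /\
    pair n y ∈ f.

Definition exp : Prop := forall n, exists y, is_pow2 n y.

Definition RCA0_star : Prop :=
  basic_axioms /\ IDelta00 /\ Delta01_comprehension /\ exp.

(** ** Combinatorial principles *)

(** The pair {x, y} with x < y is represented by [pair x y]. *)
Definition unordered_pairs (p : num M) : Prop :=
  exists x y, x < y /\ p = pair x y.

Definition two (k : num M) : Prop := k = 0 \/ k = 1.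

Definition l_RT22 : Prop :=
  forall c : nset M, is_function c unordered_pairs two ->
  exists H : nset M, cardinality_N H /\
    exists k, forall x y, x ∈ H -> y ∈ H -> x < y -> pair (pair x y) k ∈ c.

Definition partial_order (R : nset M) : Prop :=
  (forall p, p ∈ R -> times full full p) /\
  (forall x, pair x x ∈ R) /\
  (forall x y, pair x y ∈ R -> pair y x ∈ R -> x = y) /\
  (forall x y z, pair x y ∈ R -> pair y z ∈ R -> pair x z ∈ R).

Definition linear_order (R : nset M) : Prop :=
  partial_order R /\ (forall x y, pair x y ∈ R \/ pair y x ∈ R).

Definition chain (R A : nset M) : Prop :=
  forall x y, x ∈ A -> y ∈ A -> pair x y ∈ R \/ pair y x ∈ R.

Definition antichain (R A : nset M) : Prop :=
  forall x y, x ∈ A -> y ∈ A -> x <> y -> ~ pair x y ∈ R /\ ~ pair y x ∈ R.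

Definition l_CAC : Prop :=
  forall R : nset M, partial_order R ->
  exists A : nset M, cardinality_N A /\ (chain R A \/ antichain R A).

Definition l_ADS_st : Prop :=
  forall R : nset M, linear_order R ->
  exists A : nset M, cardinality_N A /\
    ((forall x y, x ∈ A -> y ∈ A -> (le x y <-> pair x y ∈ R)) \/
     (forall x y, x ∈ A -> y ∈ A -> (le x y <-> pair y x ∈ R))).

End Structure.

Definition implies_over (T P Q : L2_structure -> Prop) : Prop :=
  forall M : L2_structure, T M -> P M -> Q M.

(* Main.v *)
From Stdlib Require Import Classical Ring Arith.
Require Import Defs.

(** Suppose that P is Σ⁰₁, holds at 0 and is closed under successor, but fails
    at b.  Call the least n that has no witness y < x for P n the level of x.
    It is at most b and nondecreasing in x, and it takes every value only on a
    bounded interval, because P holds at every level.  So the numbers split into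
    bounded intervals, fewer than b + 2 of them, and the partition is Δ⁰₀.  A set
    of cardinality ℕ is unbounded and by the pigeonhole principle meets some
    interval twice; hence it is neither contained in one interval nor a partial
    transversal.  Colouring pairs by "same interval", ordering the intervals as
    antichains one after the other, and reversing the order inside each interval
    refute the three principles. *)

(** Interleaves two assignments, so that formulas with different parameters can
    be renamed to share one. *)
Definition mix (T : Type) (f g : nat -> T) (i : nat) : T :=
  if Nat.even i then f (Nat.div2 i) else g (Nat.div2 i).
Arguments mix {T} f g i.

Lemma mix_even (T : Type) (f g : nat -> T) (i : nat) : mix f g (2 * i) = f i.
Proof.
  unfold mix. rewrite Nat.div2_double, Nat.even_even. reflexivity.
Qed.

Lemma mix_odd (T : Type) (f g : nat -> T) (i : nat) : mix f g (2 * i + 1) = g i.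
Proof.
  unfold mix. rewrite Nat.even_odd.
  replace (2 * i + 1) with (S (2 * i)) by ring.
  rewrite Nat.div2_succ_double. reflexivity.
Qed.

(** * Renaming of variables in terms and formulas *)

Definition up (r : nat -> nat) : nat -> nat := scons 0 (fun i => S (r i)).

Fixpoint upn (k : nat) (r : nat -> nat) : nat -> nat :=
  match k with
  | O => r
  | S k' => up (upn k' r)
  end.

Fixpoint ren_term (r : nat -> nat) (t : term) : term :=
  match t with
  | tvar i => tvar (r i)
  | tzero => tzero
  | tone => tone
  | tadd t u => tadd (ren_term r t) (ren_term r u)
  | tmul t u => tmul (ren_term r t) (ren_term r u)
  end.

(** Only [r] is lifted at quantifiers, since set variables are never bound. *)
Fixpoint ren (s r : nat -> nat) (p : Delta00) : Delta00 :=
  match p with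
  | feq t u => feq (ren_term r t) (ren_term r u)
  | flt t u => flt (ren_term r t) (ren_term r u)
  | fmem t X => fmem (ren_term r t) (s X)
  | fnot q => fnot (ren s r q)
  | fand q q' => fand (ren s r q) (ren s r q')
  | for_ q q' => for_ (ren s r q) (ren s r q')
  | fimp q q' => fimp (ren s r q) (ren s r q')
  | ball t q => ball (ren_term r t) (ren s (up r) q)
  | bex t q => bex (ren_term r t) (ren s (up r) q)
  end.

(** * Δ⁰₀-definable predicates *)

Section Structure.

Variable M : L2_structure.
(** Supplies the set assignment of formulas without set variables; the sort of sets is not known to
    be inhabited in advance. *)
Variable X0 : nset M.

Lemma eval_ren (r : nat -> nat) (e e' : nat -> num M) (t : term) :
  (forall i, e (r i) = e' i) -> eval M e (ren_term r t) = eval M e' t.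
Proof.
  intros He. induction t; simpl; congruence.
Qed.

Lemma sat_ren (s : nat -> nat) (E E' : nat -> nset M) (p : Delta00) :
  (forall X, E (s X) = E' X) ->
  forall r e e', (forall i, e (r i) = e' i) ->
  (sat M E e (ren s r p) <-> sat M E' e' p).
Proof.
  intros HE.
  assert (Hup : forall r (e e' : nat -> num M) x, (forall i, e (r i) = e' i) ->
      forall i, scons x e (up r i) = scons x e' i)
    by (intros r e e' x He [|i]; simpl; auto).
  induction p; intros r e e' He; simpl;
    rewrite ?(eval_ren r e e' _ He).
  1,2: tauto.
  - rewrite HE. tauto.
  - rewrite (IHp r e e' He). tauto.
  - rewrite (IHp1 r e e' He), (IHp2 r e e' He). tauto.
  - rewrite (IHp1 r e e' He), (IHp2 r e e' He). tauto.
  - rewrite (IHp1 r e e' He), (IHp2 r e e' He). tauto.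
  - split; intros H x Hx; specialize (H x Hx);
      apply (IHp (up r) (scons x e) (scons x e') (Hup r e e' x He)); exact H.
  - split; intros [x [Hx H]]; exists x; (split; [exact Hx|]);
      apply (IHp (up r) (scons x e) (scons x e') (Hup r e e' x He)); exact H.
Qed.

(** As nested pairs, the bound variables of a predicate are visible as projections, which [d0] can
    match. *)
Fixpoint Ctx (k : nat) : Type :=
  match k with
  | O => unit
  | S k' => (Ctx k' * num M)%type
  end.

Fixpoint env (k : nat) (e : nat -> num M) : Ctx k -> nat -> num M :=
  match k with
  | O => fun _ => e
  | S k' => fun a => scons (snd a) (env k' e (fst a))
  end.

Lemma env_upn (k : nat) (r : nat -> nat) (e e' : nat -> num M) (a : Ctx k) :
  (forall i, e (r i) = e' i) ->
  forall i, env k e a (upn k r i) = env k e' a i.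
Proof.
  intros He. induction k as [|k IH]; simpl; [exact He|].
  intros [|i]; simpl; auto.
Qed.

(** Definability in [k] variables, with arbitrary number and set parameters.
    The most recently bound variable of [a : Ctx k] is [snd a]. *)
Definition Tm (k : nat) (t : Ctx k -> num M) : Prop :=
  exists u e, forall a, eval M (env k e a) u = t a.

Definition D0 (k : nat) (P : Ctx k -> Prop) : Prop :=
  exists p E e, forall a, sat M E (env k e a) p <-> P a.

(** [Tm] and [D0] let each formula choose its own parameters, whereas a connective evaluates both
    sides under one assignment. Fixing the assignment allows two formulas to be brought to a common
    one. *)
Definition Tm_at (e : nat -> num M) (k : nat) (t : Ctx k -> num M) : Prop :=
  exists u, forall a, eval M (env k e a) u = t a.

Definition D0_at (E : nat -> nset M) (e : nat -> num M) (k : nat)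
    (P : Ctx k -> Prop) : Prop :=
  exists p, forall a, sat M E (env k e a) p <-> P a.

(** The parameters of one side move to the even positions, those of the other to the odd positions;
    [upn k] leaves the [k] bound variables in place. *)
Lemma Tm_at_mix (e1 e2 : nat -> num M) (k : nat) (t : Ctx k -> num M) :
  Tm_at e1 k t \/ Tm_at e2 k t -> Tm_at (mix e1 e2) k t.
Proof.
  intros [[u Hu]|[u Hu]].
  - exists (ren_term (upn k (fun i => 2 * i)) u). intros a. rewrite <- Hu.
    apply eval_ren, env_upn, mix_even.
  - exists (ren_term (upn k (fun i => 2 * i + 1)) u). intros a. rewrite <- Hu.
    apply eval_ren, env_upn, mix_odd.
Qed.

Lemma D0_at_mix (E1 E2 : nat -> nset M) (e1 e2 : nat -> num M) (k : nat)
    (P : Ctx k -> Prop) :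
  D0_at E1 e1 k P \/ D0_at E2 e2 k P -> D0_at (mix E1 E2) (mix e1 e2) k P.
Proof.
  intros [[p Hp]|[p Hp]].
  - exists (ren (fun i => 2 * i) (upn k (fun i => 2 * i)) p).
    intros a. rewrite <- Hp.
    apply sat_ren; [apply mix_even | apply env_upn, mix_even].
  - exists (ren (fun i => 2 * i + 1) (upn k (fun i => 2 * i + 1)) p).
    intros a. rewrite <- Hp.
    apply sat_ren; [apply mix_odd | apply env_upn, mix_odd].
Qed.

Lemma Tm_common (k : nat) (t u : Ctx k -> num M) :
  Tm k t -> Tm k u -> exists e, Tm_at e k t /\ Tm_at e k u.
Proof.
  intros (x & e1 & Hx) (y & e2 & Hy). exists (mix e1 e2).
  split; apply Tm_at_mix; [left; exists x | right; exists y]; assumption.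
Qed.

Lemma D0_common (k l : nat) (P : Ctx k -> Prop) (Q : Ctx l -> Prop) :
  D0 k P -> D0 l Q -> exists E e, D0_at E e k P /\ D0_at E e l Q.
Proof.
  intros (p & E1 & e1 & Hp) (q & E2 & e2 & Hq). exists (mix E1 E2), (mix e1 e2).
  split; apply D0_at_mix; [left; exists p | right; exists q]; assumption.
Qed.

Lemma Tm_D0_common (k l : nat) (t : Ctx k -> num M) (Q : Ctx l -> Prop) :
  Tm k t -> D0 l Q -> exists E e, Tm_at e k t /\ D0_at E e l Q.
Proof.
  (* A term has no set parameters, so [E2] is interleaved with itself. *)
  intros (u & e1 & Hu) (q & E2 & e2 & Hq). exists (mix E2 E2), (mix e1 e2).
  split; [apply Tm_at_mix; left; exists u | apply D0_at_mix; right; exists q];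
    assumption.
Qed.

Lemma Tm_const (k : nat) (c : num M) : Tm k (fun _ => c).
Proof.
  (* Index [k] is the first one past the context, where the assignment constantly equal to [c]
     begins. *)
  exists (ren_term (upn k (fun i => i)) (tvar k)), (fun _ => c).
  intros a. rewrite (eval_ren _ _ (env k (fun _ => c) a)).
  - simpl. induction k as [|k IH]; simpl; auto.
  - apply env_upn. reflexivity.
Qed.

Lemma Tm_snd (k : nat) : Tm (S k) (fun a => snd a).
Proof.
  exists (tvar 0), (fun _ => zero M). reflexivity.
Qed.

Lemma Tm_fst (k : nat) (t : Ctx k -> num M) :
  Tm k t -> Tm (S k) (fun a => t (fst a)).
Proof.
  intros (u & e & Hu). exists (ren_term S u), e. intros a.
  rewrite <- Hu. apply eval_ren. reflexivity.
Qed.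

Lemma Tm_add (k : nat) (t u : Ctx k -> num M) :
  Tm k t -> Tm k u -> Tm k (fun a => add M (t a) (u a)).
Proof.
  intros Ht Hu. destruct (Tm_common k t u Ht Hu) as (e & [x Hx] & [y Hy]).
  exists (tadd x y), e. intros a. simpl. rewrite Hx, Hy. reflexivity.
Qed.

Lemma Tm_mul (k : nat) (t u : Ctx k -> num M) :
  Tm k t -> Tm k u -> Tm k (fun a => mul M (t a) (u a)).
Proof.
  intros Ht Hu. destruct (Tm_common k t u Ht Hu) as (e & [x Hx] & [y Hy]).
  exists (tmul x y), e. intros a. simpl. rewrite Hx, Hy. reflexivity.
Qed.

Lemma Tm_pair (k : nat) (t u : Ctx k -> num M) :
  Tm k t -> Tm k u -> Tm k (fun a => pair M (t a) (u a)).
Proof.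
  intros Ht Hu. unfold pair.
  apply Tm_add; [|exact Ht]. apply Tm_mul; apply Tm_add; assumption.
Qed.

Lemma D0_eq (k : nat) (t u : Ctx k -> num M) :
  Tm k t -> Tm k u -> D0 k (fun a => t a = u a).
Proof.
  intros Ht Hu. destruct (Tm_common k t u Ht Hu) as (e & [x Hx] & [y Hy]).
  exists (feq x y), (fun _ => X0), e. intros a. simpl. rewrite Hx, Hy. tauto.
Qed.

Lemma D0_lt (k : nat) (t u : Ctx k -> num M) :
  Tm k t -> Tm k u -> D0 k (fun a => lt M (t a) (u a)).
Proof.
  intros Ht Hu. destruct (Tm_common k t u Ht Hu) as (e & [x Hx] & [y Hy]).
  exists (flt x y), (fun _ => X0), e. intros a. simpl. rewrite Hx, Hy. tauto.
Qed.

Lemma D0_mem (k : nat) (t : Ctx k -> num M) (A : nset M) :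
  Tm k t -> D0 k (fun a => mem M (t a) A).
Proof.
  intros (x & e & Hx). exists (fmem x 0), (fun _ => A), e.
  intros a. simpl. rewrite Hx. tauto.
Qed.

Lemma D0_not (k : nat) (P : Ctx k -> Prop) : D0 k P -> D0 k (fun a => ~ P a).
Proof.
  intros (p & E & e & Hp). exists (fnot p), E, e.
  intros a. simpl. rewrite Hp. tauto.
Qed.

Lemma D0_and (k : nat) (P Q : Ctx k -> Prop) :
  D0 k P -> D0 k Q -> D0 k (fun a => P a /\ Q a).
Proof.
  intros HP HQ. destruct (D0_common _ _ P Q HP HQ) as (E & e & [p Hp] & [q Hq]).
  exists (fand p q), E, e. intros a. simpl. rewrite Hp, Hq. tauto.
Qed.

Lemma D0_or (k : nat) (P Q : Ctx k -> Prop) :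
  D0 k P -> D0 k Q -> D0 k (fun a => P a \/ Q a).
Proof.
  intros HP HQ. destruct (D0_common _ _ P Q HP HQ) as (E & e & [p Hp] & [q Hq]).
  exists (for_ p q), E, e. intros a. simpl. rewrite Hp, Hq. tauto.
Qed.

Lemma D0_imp (k : nat) (P Q : Ctx k -> Prop) :
  D0 k P -> D0 k Q -> D0 k (fun a => P a -> Q a).
Proof.
  intros HP HQ. destruct (D0_common _ _ P Q HP HQ) as (E & e & [p Hp] & [q Hq]).
  exists (fimp p q), E, e. intros a. simpl. rewrite Hp, Hq. tauto.
Qed.

Lemma D0_ball (k : nat) (t : Ctx k -> num M) (Q : Ctx k -> num M -> Prop) :
  Tm k t -> D0 (S k) (fun a => Q (fst a) (snd a)) ->
  D0 k (fun a => forall x, lt M x (t a) -> Q a x).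
Proof.
  intros Ht HQ. destruct (Tm_D0_common k (S k) t _ Ht HQ) as (E & e & [u Hu] & [q Hq]).
  exists (ball u q), E, e. intros a. simpl. rewrite Hu.
  split; intros H x Hx; apply (Hq (a, x)); apply H; exact Hx.
Qed.

Lemma D0_bex (k : nat) (t : Ctx k -> num M) (Q : Ctx k -> num M -> Prop) :
  Tm k t -> D0 (S k) (fun a => Q (fst a) (snd a)) ->
  D0 k (fun a => exists x, lt M x (t a) /\ Q a x).
Proof.
  intros Ht HQ. destruct (Tm_D0_common k (S k) t _ Ht HQ) as (E & e & [u Hu] & [q Hq]).
  exists (bex u q), E, e. intros a. simpl. rewrite Hu.
  split; intros [x [Hx H]]; exists x; (split; [exact Hx|]); apply (Hq (a, x)); exact H.
Qed.

(** Inserts an oldest variable on which [R] does not depend; in [relation_comprehension] it is the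
    code of the pair. *)
Lemma D0_rel_weaken (R : num M -> num M -> Prop) :
  D0 2 (fun a => R (snd (fst a)) (snd a)) ->
  D0 3 (fun a => R (snd (fst a)) (snd a)).
Proof.
  intros (p & E & e & Hp).
  exists (ren (fun X => X) (upn 2 S) p), E, e. intros a.
  rewrite <- (Hp ((tt, snd (fst a)), snd a)).
  apply sat_ren; [reflexivity|]. intros [|[|i]]; reflexivity.
Qed.


(** Builds a defining formula by recursion on the syntactic form of the predicate. Goals of no
    listed form, such as definability of an abstract predicate, are left to the caller. *)
Ltac d0 :=
  cbv beta; unfold le;
  lazymatch goal with
  | |- Tm _ (fun a => add _ _ _) => apply Tm_add; d0
  | |- Tm _ (fun a => mul _ _ _) => apply Tm_mul; d0
  | |- Tm _ (fun a => pair _ _ _) => apply Tm_pair; d0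
  | |- Tm _ snd => apply Tm_snd
  | |- Tm _ (fun a => snd a) => apply Tm_snd
  | |- Tm (S ?k) (fun a => snd (fst a)) => apply (Tm_fst k (fun a => snd a)); d0
  | |- Tm (S ?k) (fun a => snd (fst (fst a))) =>
      apply (Tm_fst k (fun a => snd (fst a))); d0
  | |- Tm (S ?k) (fun a => snd (fst (fst (fst a)))) =>
      apply (Tm_fst k (fun a => snd (fst (fst a)))); d0
  | |- Tm (S ?k) (fun a => snd (fst (fst (fst (fst a))))) =>
      apply (Tm_fst k (fun a => snd (fst (fst (fst a))))); d0
  | |- Tm (S ?k) (fun a => snd (fst (fst (fst (fst (fst a)))))) =>
      apply (Tm_fst k (fun a => snd (fst (fst (fst (fst a)))))); d0
  | |- Tm _ (fun a => _) => apply Tm_const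
  | |- D0 _ (fun a => _ = _) => apply D0_eq; d0
  | |- D0 _ (fun a => lt _ _ _) => apply D0_lt; d0
  | |- D0 _ (fun a => mem _ _ _) => apply D0_mem; d0
  | |- D0 ?k (fun a => ~ @?P a) => apply (D0_not k P); d0
  | |- D0 ?k (fun a => @?P a /\ @?Q a) => apply (D0_and k P Q); d0
  | |- D0 ?k (fun a => @?P a \/ @?Q a) => apply (D0_or k P Q); d0
  | |- D0 ?k (fun a => exists x, lt _ x (@?t a) /\ @?Q a x) =>
      apply (D0_bex k t Q); d0
  | |- D0 ?k (fun a => forall x, lt _ x (@?t a) -> @?Q a x) =>
      apply (D0_ball k t Q); d0
  | |- D0 ?k (fun a => @?P a -> @?Q a) => apply (D0_imp k P Q); d0
  | |- _ => idtac
  end.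

Local Notation "0" := (zero M).
Local Notation "1" := (one M).
Local Notation "x + y" := (add M x y).
Local Notation "x * y" := (mul M x y).
Local Notation "x < y" := (lt M x y).
Local Notation "x <= y" := (le M x y).
Local Notation "x ∈ A" := (mem M x A) (at level 70).

(** * Induction and comprehension for Δ⁰₀ predicates *)

Variable basic : basic_axioms M.
Variable IDelta : IDelta00 M.
Variable comprehension : Delta01_comprehension M.

Lemma D0_ind (P : num M -> Prop) :
  D0 1 (fun a => P (snd a)) ->
  P 0 -> (forall n, P n -> P (n + 1)) -> forall n, P n.
Proof.
  intros (p & E & e & Hp) H0 Hs n.
  apply (Hp (tt, n)), (IDelta p E e).
  - apply (Hp (tt, 0)), H0.
  - intros m Hm. apply (Hp (tt, m + 1)), Hs, (Hp (tt, m)), Hm.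
Qed.

Ltac num_ind n :=
  revert n;
  lazymatch goal with |- forall n, @?P n => apply (D0_ind P) end.

Lemma D0_comprehension (P : num M -> Prop) :
  D0 1 (fun a => P (snd a)) -> exists A, forall n, n ∈ A <-> P n.
Proof.
  intros (p & E & e & Hp).
  (* A dummy variable at index 0 makes the same matrix serve as a Σ⁰₁ and as a Π⁰₁ definition. *)
  set (q := ren (fun X => X) S p).
  assert (Hq : forall n y, sat M E (scons y (scons n e)) q <-> P n).
  { intros n y. rewrite <- (Hp (tt, n)). apply sat_ren; reflexivity. }
  destruct (comprehension q q E e) as [A HA].
  - intros n. unfold def_Sigma01, def_Pi01. split.
    + intros [y Hy] z. apply Hq, (Hq n y), Hy.
    + intros H. exists 0. apply H.
  - exists A. intros n. rewrite HA. unfold def_Sigma01. split.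
    + intros [y Hy]. apply (Hq n y), Hy.
    + intros H. exists 0. apply Hq, H.
Qed.

(** * Arithmetic *)

Lemma succ_neq_0 (n : num M) : n + 1 <> 0.
Proof. apply basic. Qed.

Lemma succ_inj (m n : num M) : m + 1 = n + 1 -> m = n.
Proof. apply basic. Qed.

Lemma add_0_r (m : num M) : m + 0 = m.
Proof. apply basic. Qed.

Lemma add_succ_r (m n : num M) : m + (n + 1) = (m + n) + 1.
Proof. apply basic. Qed.

Lemma mul_0_r (m : num M) : m * 0 = 0.
Proof. apply basic. Qed.

Lemma mul_succ_r (m n : num M) : m * (n + 1) = m * n + m.
Proof. apply basic. Qed.

Lemma not_lt_0 (m : num M) : ~ m < 0.
Proof. apply basic. Qed.

Lemma lt_succ_iff (m n : num M) : m < n + 1 <-> m < n \/ m = n.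
Proof. apply basic. Qed.

Lemma add_0_l (n : num M) : 0 + n = n.
Proof.
  num_ind n; [d0 | apply add_0_r |].
  intros n H. rewrite add_succ_r, H. reflexivity.
Qed.

Lemma add_succ_l (m n : num M) : (m + 1) + n = (m + n) + 1.
Proof.
  num_ind n; [d0 | rewrite !add_0_r; reflexivity |].
  intros n H. rewrite !add_succ_r, H. reflexivity.
Qed.

Lemma add_comm (m n : num M) : m + n = n + m.
Proof.
  num_ind n; [d0 | rewrite add_0_r, add_0_l; reflexivity |].
  intros n H. rewrite add_succ_r, add_succ_l, H. reflexivity.
Qed.

Lemma add_assoc (m n k : num M) : m + (n + k) = (m + n) + k.
Proof.
  num_ind k; [d0 | rewrite !add_0_r; reflexivity |].
  intros k H. rewrite !add_succ_r, H. reflexivity.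
Qed.

Lemma mul_0_l (n : num M) : 0 * n = 0.
Proof.
  num_ind n; [d0 | apply mul_0_r |].
  intros n H. rewrite mul_succ_r, H. apply add_0_r.
Qed.

Lemma mul_succ_l (m n : num M) : (m + 1) * n = m * n + n.
Proof.
  num_ind n; [d0 | rewrite !mul_0_r, add_0_r; reflexivity |].
  intros n H. rewrite !mul_succ_r, H, !add_succ_r.
  rewrite <- (add_assoc _ n m), (add_comm n m), add_assoc. reflexivity.
Qed.

Lemma mul_comm (m n : num M) : m * n = n * m.
Proof.
  num_ind n; [d0 | rewrite mul_0_r, mul_0_l; reflexivity |].
  intros n H. rewrite mul_succ_r, mul_succ_l, H. reflexivity.
Qed.

Lemma mul_add_distr_l (k m n : num M) : k * (m + n) = k * m + k * n.
Proof.
  num_ind n; [d0 | rewrite mul_0_r, !add_0_r; reflexivity |].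
  intros n H. rewrite add_succ_r, !mul_succ_r, H, add_assoc. reflexivity.
Qed.

Lemma mul_assoc (m n k : num M) : m * (n * k) = (m * n) * k.
Proof.
  num_ind k; [d0 | rewrite !mul_0_r; reflexivity |].
  intros k H. rewrite !mul_succ_r, mul_add_distr_l, H. reflexivity.
Qed.

Lemma num_semi_ring : semi_ring_theory 0 1 (add M) (mul M) eq.
Proof.
  constructor.
  - apply add_0_l.
  - apply add_comm.
  - apply add_assoc.
  - intros n. rewrite <- (add_0_l 1), mul_succ_l, mul_0_l, add_0_l. reflexivity.
  - apply mul_0_l.
  - apply mul_comm.
  - apply mul_assoc.
  - intros n m p. rewrite !(mul_comm _ p). apply mul_add_distr_l.
Qed.

Add Ring num_ring : num_semi_ring.

Lemma add_cancel_r (x y z : num M) : x + z = y + z -> x = y.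
Proof.
  num_ind z; [d0 | rewrite !add_0_r; auto |].
  intros z H. rewrite !add_succ_r. intros Hs. apply H, succ_inj, Hs.
Qed.

Lemma lt_succ_succ (d y : num M) : d < y -> d + 1 < y + 1.
Proof.
  num_ind y; [d0 | intros H; destruct (not_lt_0 _ H) |].
  intros y IH. rewrite !lt_succ_iff. intros [H|H].
  - left. rewrite <- lt_succ_iff. exact (IH H).
  - right. congruence.
Qed.

Lemma lt_succ (x : num M) : x < x + 1.
Proof. apply lt_succ_iff. right. reflexivity. Qed.

Lemma lt_0_succ (x : num M) : 0 < x + 1.
Proof.
  num_ind x; [d0 | apply lt_succ |].
  intros x H. apply lt_succ_iff. left. exact H.
Qed.

Lemma lt_diff (x y : num M) : x < y -> exists d, y = x + d + 1.
Proof.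
  (* The bound on [d] makes the induction Δ⁰₀. *)
  enough (H : x < y -> exists d, d < y /\ y = x + d + 1).
  { intros Hx. destruct (H Hx) as (d & _ & Hd). exists d. exact Hd. }
  num_ind y; [d0 | intros H; destruct (not_lt_0 _ H) |].
  intros y IH. rewrite lt_succ_iff. intros [H|<-].
  - destruct (IH H) as (d & Hd & E). exists (d + 1). split.
    + apply lt_succ_succ, Hd.
    + rewrite E at 1. ring.
  - exists 0. split; [apply lt_0_succ | ring].
Qed.

Lemma lt_add_succ (x d : num M) : x < x + d + 1.
Proof.
  num_ind d; [d0 | apply lt_succ_iff; right; ring |].
  intros d H. apply lt_succ_iff. left. rewrite add_assoc. exact H.
Qed.

Lemma add_succ_neq (x d : num M) : x <> x + d + 1.
Proof.
  intros H. apply (succ_neq_0 d), (add_cancel_r _ _ x).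
  transitivity x; [rewrite H at 2|]; ring.
Qed.

Lemma lt_irrefl (x : num M) : ~ x < x.
Proof.
  intros H. destruct (lt_diff _ _ H) as [d Hd]. exact (add_succ_neq _ _ Hd).
Qed.

Lemma lt_trans (x y z : num M) : x < y -> y < z -> x < z.
Proof.
  intros H1 H2. destruct (lt_diff _ _ H1) as [d ->], (lt_diff _ _ H2) as [d' ->].
  replace (x + d + 1 + d' + 1) with (x + (d + 1 + d') + 1) by ring.
  apply lt_add_succ.
Qed.

Lemma lt_le_trans (x y z : num M) : x < y -> y <= z -> x < z.
Proof. intros H [H'|<-]; [exact (lt_trans _ _ _ H H') | exact H]. Qed.

Lemma le_lt_trans (x y z : num M) : x <= y -> y < z -> x < z.
Proof. intros [H| ->] H'; [exact (lt_trans _ _ _ H H') | exact H']. Qed.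

Lemma le_refl (x : num M) : x <= x.
Proof. right. reflexivity. Qed.

Lemma le_trans (x y z : num M) : x <= y -> y <= z -> x <= z.
Proof. intros H [H'|<-]; [left; exact (le_lt_trans _ _ _ H H') | exact H]. Qed.

Lemma le_add_r (x d : num M) : x <= x + d.
Proof.
  num_ind d; [d0 | right; ring |].
  intros d _. left. rewrite add_assoc. apply lt_add_succ.
Qed.

Lemma le_0_l (x : num M) : 0 <= x.
Proof. rewrite <- (add_0_l x). apply le_add_r. Qed.

Lemma lt_succ_le (x y : num M) : x < y -> x + 1 <= y.
Proof.
  intros H. destruct (lt_diff _ _ H) as [d ->].
  replace (x + d + 1) with (x + 1 + d) by ring. apply le_add_r.
Qed.

Lemma lt_or_ge (x y : num M) : x < y \/ y <= x.
Proof.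
  num_ind y; [d0 | right; apply le_0_l |].
  intros y [H|[H| ->]].
  - left. apply lt_succ_iff. left. exact H.
  - right. apply lt_succ_le, H.
  - left. apply lt_succ.
Qed.

Lemma lt_not_le (x y : num M) : x < y -> ~ y <= x.
Proof. intros H H'. exact (lt_irrefl _ (lt_le_trans _ _ _ H H')). Qed.

Lemma le_antisymm (x y : num M) : x <= y -> y <= x -> x = y.
Proof. intros [H| ->] H'; [destruct (lt_not_le _ _ H H') | reflexivity]. Qed.

(** * The least number principle and the pairing function *)

Lemma D0_least (P : num M -> Prop) (b : num M) :
  D0 1 (fun a => P (snd a)) -> P b ->
  exists j, j <= b /\ P j /\ forall i, i < j -> ~ P i.
Proof.
  intros HP Hb. apply NNPP. intros Hn.
  assert (H : forall n, forall i, i < n -> ~ (i <= b /\ P i)).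
  { apply (D0_ind (fun n => forall i, i < n -> ~ (i <= b /\ P i))).
    - d0. destruct HP as (p & E & e & Hp).
      (* [P] is abstract, so its formula is renamed by hand: index 0 stays [i], and index 1, now
         [n], is skipped. *)
      exists (ren (fun X => X) (up (fun i => S i)) p), E, e. intros a.
      rewrite <- (Hp (tt, snd a)).
      apply sat_ren; [reflexivity|]. intros [|i]; reflexivity.
    - intros i H. destruct (not_lt_0 _ H).
    - intros n IH i Hi [Hib HPi]. apply lt_succ_iff in Hi. destruct Hi as [Hi| ->].
      + exact (IH i Hi (conj Hib HPi)).
      + apply Hn. exists n. split; [exact Hib|]. split; [exact HPi|].
        intros i Hi Hi'. apply (IH i Hi). split; [|exact Hi'].
        left. exact (lt_le_trans _ _ _ Hi Hib). }
  exact (H (b + 1) b (lt_succ b) (conj (le_refl b) Hb)).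
Qed.

(** With s = i + j, the code lies between s² and s² + s, hence below (s + 1)². *)
Lemma pair_sum_le (i j i' j' : num M) :
  pair M i j = pair M i' j' -> i + j <= i' + j'.
Proof.
  intros H. destruct (lt_or_ge (i' + j') (i + j)) as [Hlt|Hge]; [|exact Hge].
  destruct (lt_diff _ _ Hlt) as [d Hd]. unfold pair in H. rewrite Hd in H.
  (* The second argument is the excess of the left code over the right one, less 1, expanded from i
     + j = i' + j' + d + 1. *)
  destruct (add_succ_neq ((i' + j') * (i' + j') + i')
    (i' + j' + j' + (1 + 1) * (i' + j') * d + d * d + (1 + 1) * d + i)).
  rewrite <- H at 1. ring.
Qed.

Lemma pair_inj (i j i' j' : num M) :
  pair M i j = pair M i' j' -> i = i' /\ j = j'.
Proof.
  intros H.
  assert (Hs : i + j = i' + j')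
    by (apply le_antisymm; apply pair_sum_le; congruence).
  unfold pair in H. rewrite Hs, !(add_comm ((i' + j') * (i' + j'))) in H.
  apply add_cancel_r in H. subst i'. split; [reflexivity|].
  apply (add_cancel_r _ _ i). rewrite !(add_comm _ i). exact Hs.
Qed.

Lemma le_square (x : num M) : x <= x * x.
Proof.
  num_ind x; [d0 | right; ring |].
  intros x _. replace ((x + 1) * (x + 1)) with (x + 1 + (x * x + x)) by ring.
  apply le_add_r.
Qed.

Lemma pair_bound_l (i j : num M) : i < pair M i j + 1.
Proof.
  apply lt_succ_iff. unfold pair. rewrite add_comm. apply le_add_r.
Qed.

Lemma pair_bound_r (i j : num M) : j < pair M i j + 1.
Proof.
  apply lt_succ_iff. unfold pair.
  apply le_trans with (i + j); [rewrite add_comm; apply le_add_r|].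
  apply le_trans with ((i + j) * (i + j)); [apply le_square | apply le_add_r].
Qed.

(** Both coordinates are bounded by the code, so the set of codes is Δ⁰₀. The second clause serves
    [is_function] and [partial_order], which admit only codes of pairs. *)
Lemma relation_comprehension (R : num M -> num M -> Prop) :
  D0 2 (fun a => R (snd (fst a)) (snd a)) ->
  exists A, (forall x y, pair M x y ∈ A <-> R x y) /\
            (forall p, p ∈ A -> exists x y, p = pair M x y).
Proof.
  intros HR.
  destruct (D0_comprehension (fun p => exists x, x < p + 1 /\
      exists y, y < p + 1 /\ p = pair M x y /\ R x y)) as [A HA].
  { d0. apply D0_rel_weaken, HR. }
  exists A. split.
  - intros x y. rewrite HA. split.
    + intros (x' & _ & y' & _ & E & H).
      apply pair_inj in E. destruct E as [-> ->]. exact H.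
    + intros H. exists x. split; [apply pair_bound_l|].
      exists y. split; [apply pair_bound_r|]. split; [reflexivity | exact H].
  - intros p Hp. apply HA in Hp. destruct Hp as (x & _ & y & _ & E & _).
    exists x, y. exact E.
Qed.

(** * The pigeonhole principle *)

Lemma zero_or_succ (x : num M) : x = 0 \/ exists y, x = y + 1.
Proof.
  destruct (le_0_l x) as [H|H]; [right | left; congruence].
  destruct (lt_diff _ _ H) as [d ->]. exists d. ring.
Qed.

Lemma pow2_0 (b : num M) (f : nset M) (v : num M) :
  is_function M f (fun i => i <= b) (full M) ->
  pair M 0 1 ∈ f -> pair M 0 v ∈ f -> v = 1.
Proof.
  intros [_ Hf] H1 Hv. destruct (Hf 0 (le_0_l b)) as [u [_ Hu]].
  rewrite <- (Hu _ H1), <- (Hu _ Hv). reflexivity.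
Qed.

(* Cantor's diagonal by repeated halving: for k = 0, ..., b there is an interval
   of length 2^(b-k) below 2^b in which h takes no value below k.  One half of
   it omits the value k, as k is attained at most once.  This weak pigeonhole
   principle needs no coding of finite sequences by numbers. *)
Lemma no_injection_from_pow2 (b B : num M) (h : nset M) :
  is_pow2 M b B ->
  (forall x, x < B -> exists j, j < b /\ pair M x j ∈ h) ->
  (forall x x' j, pair M x j ∈ h -> pair M x' j ∈ h -> x = x') ->
  False.
Proof.
  intros (f & Hfun & Hf0 & Hfs & HfB) Htot Hinj.
  (* Here l = 2^m with m = b - k, and the current interval is [a, a + l). The explicit bounds on m,
     l and a keep the induction Δ⁰₀. *)
  assert (H : forall k, k <= b -> exists m, m < b + 1 /\ k + m = b /\
    exists l, l < B + 1 /\ pair M m l ∈ f /\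
    exists a, a < B + 1 /\ a + l <= B /\
    forall x, x < B -> a <= x -> x < a + l ->
    forall j, j < k -> ~ pair M x j ∈ h).
  { match goal with |- forall k, @?P k => apply (D0_ind P) end.
    - d0.
    - intros _. exists b. split; [apply lt_succ|]. split; [apply add_0_l|].
      exists B. split; [apply lt_succ|]. split; [exact HfB|].
      exists 0. split; [apply lt_0_succ|]. split; [right; apply add_0_l|].
      intros x _ _ _ j Hj. destruct (not_lt_0 _ Hj).
    - intros k IH Hk.
      destruct IH as (m & Hm & Hkm & l & Hl & Hml & a & Ha & Hal & Hfree).
      { left. exact (lt_le_trans _ _ _ (lt_succ k) Hk). }
      destruct (zero_or_succ m) as [->|[m' ->]].
      { rewrite add_0_r in Hkm. subst k. destruct (lt_not_le _ _ (lt_succ b) Hk). }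
      apply lt_succ_iff in Hm.
      assert (Hm'b : m' < b) by exact (lt_le_trans _ _ _ (lt_succ m') Hm).
      destruct Hfun as [_ Hfun].
      destruct (Hfun m' (or_introl Hm'b)) as [v [Hv _]].
      pose proof (Hfs m' v Hm'b Hv) as Hvs.
      destruct (Hfun (m' + 1) Hm) as [u [_ Hu]].
      assert (El : l = v + v).
      { transitivity ((1 + 1) * v); [|ring]. rewrite <- (Hu _ Hml). exact (Hu _ Hvs). }
      subst l.
      assert (Hav : a + v <= B).
      { apply le_trans with (a + (v + v)); [|exact Hal].
        rewrite add_assoc. apply le_add_r. }
      exists m'. split; [apply lt_succ_iff; left; exact Hm'b|].
      split; [rewrite <- Hkm; ring|].
      exists v. split.
      { apply lt_succ_iff, le_trans with (a + v); [|exact Hav].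
        rewrite add_comm. apply le_add_r. }
      split; [exact Hv|].
      (* If some number below a + v takes the value [k], injectivity keeps [k] out of the upper
         half; otherwise the lower half omits it. *)
      destruct (classic (exists x, x < a + v /\ pair M x k ∈ h)) as [[x0 [Hx0 Hx0k]]|Hno].
      + exists (a + v). split; [apply lt_succ_iff, Hav|].
        split; [rewrite <- add_assoc; exact Hal|].
        intros x HxB Hax Hxa j Hj Hxj. apply lt_succ_iff in Hj.
        destruct Hj as [Hj| ->].
        * apply (Hfree x HxB) with j; [| |exact Hj|exact Hxj].
          -- apply le_trans with (a + v); [apply le_add_r | exact Hax].
          -- rewrite add_assoc. exact Hxa.
        * rewrite (Hinj x x0 k Hxj Hx0k) in Hax. exact (lt_not_le _ _ Hx0 Hax).
      + exists a. split; [exact Ha|]. split; [exact Hav|].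
        intros x HxB Hax Hxa j Hj Hxj. apply lt_succ_iff in Hj.
        destruct Hj as [Hj| ->].
        * apply (Hfree x HxB Hax) with j; [|exact Hj|exact Hxj].
          apply lt_le_trans with (a + v); [exact Hxa|].
          rewrite add_assoc. apply le_add_r.
        * apply Hno. exists x. split; assumption. }
  (* At k = b the interval is the single point [a], which has no value below [b], against
     totality. *)
  destruct (H b (le_refl b)) as (m & _ & Hbm & l & _ & Hl & a & _ & Hal & Hfree).
  assert (m = 0) as ->.
  { apply (add_cancel_r _ _ b). rewrite add_0_l, add_comm. exact Hbm. }
  rewrite (pow2_0 b f l Hfun Hf0 Hl) in Hal, Hfree.
  assert (HaB : a < B) by exact (lt_le_trans _ _ _ (lt_succ a) Hal).
  destruct (Htot a HaB) as (j & Hj & Haj).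
  exact (Hfree a HaB (le_refl a) (lt_succ a) j Hj Haj).
Qed.

Variable exp_total : exp M.

(** If distinct elements of [H] never shared a label, enumerating 2^b of them and then taking labels
    would contradict [no_injection_from_pow2]. *)
Lemma cardinality_N_pigeonhole (H L : nset M) (b : num M) :
  cardinality_N M H ->
  (forall x, x ∈ H -> exists j, j < b /\ pair M x j ∈ L) ->
  exists x y j, x ∈ H /\ y ∈ H /\ x <> y /\ pair M x j ∈ L /\ pair M y j ∈ L.
Proof.
  intros HH HL. apply NNPP. intros Hno.
  destruct (exp_total b) as [B HB].
  destruct (HH B) as (F & HFH & [c Hc] & f & [Hf1 Hf2] & Hfinj & _).
  assert (HfF : forall i y, pair M i y ∈ f -> y ∈ F).
  { intros i y Hy. destruct (Hf1 _ Hy) as (i' & y' & _ & Hy' & E).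
    apply pair_inj in E. destruct E as [_ ->]. exact Hy'. }
  (* The bound [c] of the finite set [F] makes the composition Δ⁰₀. *)
  destruct (relation_comprehension (fun i j =>
      exists y, y < c /\ (pair M i y ∈ f /\ pair M y j ∈ L))) as (h & Hh & _).
  { d0. }
  apply (no_injection_from_pow2 b B h HB).
  - intros i Hi. destruct (Hf2 i Hi) as (y & Hy & _).
    destruct (HL y (HFH y (HfF _ _ Hy))) as (j & Hj & Hyj).
    exists j. split; [exact Hj|]. apply Hh. exists y.
    split; [exact (Hc y (HfF _ _ Hy)) | split; assumption].
  - intros i i' j Hi Hi'. apply Hh in Hi, Hi'.
    destruct Hi as (y & _ & Hy & Hyj), Hi' as (y' & _ & Hy' & Hyj').
    assert (y = y') as <-.
    { apply NNPP. intros Hne. apply Hno. exists y, y', j.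
      split; [apply HFH, (HfF i), Hy|]. split; [apply HFH, (HfF i'), Hy'|].
      split; [exact Hne | split; assumption]. }
    exact (Hfinj i i' y Hy Hy').
Qed.

(** Each number is labelled by itself: a set below [w] would have two distinct elements with one
    label. *)
Lemma cardinality_N_unbounded (H : nset M) (w : num M) :
  cardinality_N M H -> exists x, x ∈ H /\ w <= x.
Proof.
  intros HH. apply NNPP. intros Hno.
  destruct (relation_comprehension (fun x y => x = y)) as (L & HL & _); [d0|].
  destruct (cardinality_N_pigeonhole H L w HH) as (x & y & j & _ & _ & Hne & Hx & Hy).
  - intros x Hx. exists x. split; [|apply HL; reflexivity].
    destruct (lt_or_ge x w) as [Hlt|Hge]; [exact Hlt|].
    destruct Hno. exists x. split; assumption.
  - apply HL in Hx, Hy. congruence.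
Qed.

(** * The partition into intervals *)

(* The level of x is the least n such that no y < x witnesses P n. *)
Lemma level_function (p : Delta00) (E : nat -> nset M) (e : nat -> num M) (b : num M) :
  let P := def_Sigma01 M p E e in
  P 0 -> (forall n, P n -> P (n + 1)) -> ~ P b ->
  exists L : nset M,
    (forall x, exists j, j < b + 1 /\ pair M x j ∈ L) /\
    (forall x y i j, x <= y -> pair M x i ∈ L -> pair M y j ∈ L -> i <= j) /\
    (forall x, exists w, forall y j, w <= y -> pair M x j ∈ L -> ~ pair M y j ∈ L).
Proof.
  intros P H0 Hs Hb.
  destruct (relation_comprehension
    (fun n y => sat M E (scons y (scons n e)) p)) as (X & HX & _).
  { exists p, E, e. intros a. reflexivity. }
  destruct (relation_comprehension (fun x j =>
      (forall i, i < j -> exists y, y < x /\ pair M i y ∈ X) /\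
      ~ (exists y, y < x /\ pair M j y ∈ X))) as (L & HL & _).
  { d0. }
  assert (Htot : forall x, exists j, j < b + 1 /\ pair M x j ∈ L).
  { intros x.
    destruct (D0_least (fun j => ~ (exists y, y < x /\ pair M j y ∈ X)) b)
      as (j & Hj & HjX & Hleast).
    - d0.
    (* [b] never acquires a witness, so the least number without one is at most [b]. *)
    - intros (y & _ & Hy). apply Hb. exists y. apply HX, Hy.
    - exists j. split; [apply lt_succ_iff, Hj|]. apply HL. split; [|exact HjX].
      intros i Hi. apply NNPP, Hleast, Hi. }
  assert (Hmono : forall x y i j,
      x <= y -> pair M x i ∈ L -> pair M y j ∈ L -> i <= j).
  { intros x y i j Hxy Hi Hj. apply HL in Hi, Hj.
    destruct (lt_or_ge j i) as [Hji|Hij]; [|exact Hij].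
    destruct Hi as [Hi _], Hj as [_ Hj]. destruct Hj.
    destruct (Hi j Hji) as (z & Hz & Hjz). exists z.
    split; [exact (lt_le_trans _ _ _ Hz Hxy) | exact Hjz]. }
  exists L. split; [exact Htot|]. split; [exact Hmono|].
  intros x. destruct (Htot x) as (j & _ & Hj).
  (* A level is 0 or the successor of a number that already has a witness. *)
  assert (HPj : P j).
  { destruct (zero_or_succ j) as [->|[i ->]]; [exact H0|]. apply Hs.
    apply HL in Hj. destruct Hj as [Hj _].
    destruct (Hj i (lt_succ i)) as (y & _ & Hy). exists y. apply HX, Hy. }
  (* From w + 1 on, the witness [w] of P j counts, so the level is no longer [j]. *)
  destruct HPj as [w Hw]. exists (w + 1). intros y j' Hwy Hj' Hy.
  assert (j' = j) as -> by (apply le_antisymm;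
    apply (Hmono x x); auto using le_refl).
  apply HL in Hy. destruct Hy as [_ Hy]. apply Hy. exists w.
  split; [exact (lt_le_trans _ _ _ (lt_succ w) Hwy) | apply HX, Hw].
Qed.

(* The classes of [S] are the intervals on which the level is constant. *)
Lemma interval_equivalence :
  ~ ISigma01 M ->
  exists S : nset M,
    (forall x, pair M x x ∈ S) /\
    (forall x y, pair M x y ∈ S -> pair M y x ∈ S) /\
    (forall x y z, pair M x y ∈ S -> pair M y z ∈ S -> pair M x z ∈ S) /\
    (forall x y z, x <= y -> y <= z -> pair M x z ∈ S -> pair M x y ∈ S) /\
    (forall H, cardinality_N M H ->
      (exists x y, x ∈ H /\ y ∈ H /\ x < y /\ pair M x y ∈ S) /\
      (exists x y, x ∈ H /\ y ∈ H /\ x < y /\ ~ pair M x y ∈ S)).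
Proof.
  intros Hn.
  assert (HP : exists p E e b, def_Sigma01 M p E e 0 /\
    (forall n, def_Sigma01 M p E e n -> def_Sigma01 M p E e (n + 1)) /\
    ~ def_Sigma01 M p E e b).
  { apply NNPP. intros Hno. apply Hn. intros p E e H0 Hs b.
    apply NNPP. intros Hb. apply Hno. exists p, E, e, b. repeat split; assumption. }
  destruct HP as (p & E & e & b & H0 & Hs & Hb).
  destruct (level_function p E e b H0 Hs Hb) as (L & Htot & Hmono & Hbound).
  assert (Huniq : forall x i j, pair M x i ∈ L -> pair M x j ∈ L -> i = j).
  { intros x i j Hi Hj. apply le_antisymm; apply (Hmono x x); auto using le_refl. }
  destruct (relation_comprehension (fun x y =>
      exists j, j < b + 1 /\ (pair M x j ∈ L /\ pair M y j ∈ L))) as (S & HS & _).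
  { d0. }
  exists S. split; [|split; [|split; [|split]]].
  - intros x. apply HS. destruct (Htot x) as (j & Hj & Hx).
    exists j. auto.
  - intros x y. rewrite !HS. intros (j & Hj & Hx & Hy). exists j. auto.
  - intros x y z. rewrite !HS. intros (j & Hj & Hx & Hy) (j' & _ & Hy' & Hz).
    exists j. rewrite (Huniq y j j' Hy Hy') in *. auto.
  - intros x y z Hxy Hyz. rewrite !HS. intros (j & Hj & Hx & Hz).
    destruct (Htot y) as (j' & _ & Hy). exists j.
    assert (j' = j) as ->.
    { apply le_antisymm; [apply (Hmono y z) | apply (Hmono x y)]; assumption. }
    auto.
  - intros H HH. split.
    + destruct (cardinality_N_pigeonhole H L (b + 1) HH (fun x _ => Htot x))
        as (x & y & j & Hx & Hy & Hne & Hxj & Hyj).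
      assert (Hj : j < b + 1).
      { destruct (Htot x) as (j' & Hj' & Hx'). rewrite (Huniq x j j'); assumption. }
      destruct (lt_or_ge x y) as [Hlt|[Hlt|Heq]]; [| |congruence].
      * exists x, y. rewrite HS. repeat split; eauto.
      * exists y, x. rewrite HS. repeat split; eauto.
    + destruct (cardinality_N_unbounded H 0 HH) as (x & Hx & _).
      destruct (Hbound x) as [w Hw].
      destruct (cardinality_N_unbounded H w HH) as (y0 & Hy0 & Hwy0).
      (* An element from y0 + x + 1 on exceeds [x] and, as w <= y0, lies beyond the interval of
         [x]. *)
      destruct (cardinality_N_unbounded H (y0 + x + 1) HH) as (y & Hy & Hle).
      exists x, y. split; [exact Hx|]. split; [exact Hy|]. split.
      * apply lt_le_trans with (y0 + x + 1); [|exact Hle].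
        rewrite (add_comm y0). apply lt_add_succ.
      * rewrite HS. intros (j & _ & Hxj & Hyj).
        apply (Hw y j); [|exact Hxj|exact Hyj].
        apply le_trans with y0; [exact Hwy0|].
        apply le_trans with (y0 + x + 1); [|exact Hle].
        rewrite <- add_assoc. apply le_add_r.
Qed.

(** * The three principles *)

(** Colour 0 means same interval, colour 1 different intervals; every set of cardinality ℕ contains
    pairs of both colours. *)
Lemma l_RT22_ISigma01 : l_RT22 M -> ISigma01 M.
Proof.
  intros HRT. apply NNPP. intros Hn.
  destruct (interval_equivalence Hn) as (S & _ & _ & _ & _ & HS).
  destruct (relation_comprehension (fun p k =>
      exists x, x < p + 1 /\ exists y, y < p + 1 /\ (p = pair M x y /\ x < y /\
      ((pair M x y ∈ S /\ k = 0) \/ (~ pair M x y ∈ S /\ k = 1)))))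
    as (c & Hc & Hcp).
  { d0. }
  assert (Hc' : forall x y k, pair M (pair M x y) k ∈ c <-> x < y /\
      ((pair M x y ∈ S /\ k = 0) \/ (~ pair M x y ∈ S /\ k = 1))).
  { intros x y k. rewrite Hc. split.
    - intros (x' & _ & y' & _ & E & H). apply pair_inj in E.
      destruct E as [-> ->]. exact H.
    - intros H. exists x. split; [apply pair_bound_l|].
      exists y. split; [apply pair_bound_r|]. split; [reflexivity | exact H]. }
  assert (H01 : 0 <> 1).
  { intros H. apply (succ_neq_0 0). rewrite add_0_l. symmetry. exact H. }
  destruct (HRT c) as (H & HH & k & Hk).
  - split.
    + intros q Hq. destruct (Hcp q Hq) as (p & k & ->).
      exists p, k. apply Hc in Hq. destruct Hq as (x & _ & y & _ & -> & Hxy & Hk).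
      split; [exists x, y; auto|]. split; [|reflexivity].
      unfold two. tauto.
    + intros q (x & y & Hxy & ->). destruct (classic (pair M x y ∈ S)) as [H|H].
      * exists 0. split; [apply Hc'; auto|].
        intros k Hk. apply Hc' in Hk. destruct Hk as [_ [[_ ->]|[Hx _]]]; tauto.
      * exists 1. split; [apply Hc'; auto|].
        intros k Hk. apply Hc' in Hk. destruct Hk as [_ [[Hx _]|[_ ->]]]; tauto.
  - destruct (HS H HH) as [(x & y & Hx & Hy & Hxy & Hsame) (x' & y' & Hx' & Hy' & Hxy' & Hdiff)].
    pose proof (Hk x y Hx Hy Hxy) as H1. pose proof (Hk x' y' Hx' Hy' Hxy') as H2.
    apply Hc' in H1, H2.
    destruct H1 as [_ [[_ E1]|[H1 _]]]; [|tauto].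
    destruct H2 as [_ [[H2 _]|[_ E2]]]; [tauto|]. congruence.
Qed.

(** Distinct numbers are comparable exactly when their intervals differ, so a chain would be a
    partial transversal and an antichain would lie in one interval. *)
Lemma l_CAC_ISigma01 : l_CAC M -> ISigma01 M.
Proof.
  intros HCAC. apply NNPP. intros Hn.
  destruct (interval_equivalence Hn) as (S & _ & _ & _ & Hconv & HS).
  destruct (relation_comprehension (fun x y => x = y \/ (x < y /\ ~ pair M x y ∈ S)))
    as (R & HR & HRp).
  { d0. }
  destruct (HCAC R) as (H & HH & Hchain).
  - split; [|split; [|split]].
    + intros q Hq. destruct (HRp q Hq) as (x & y & E). exists x, y. repeat split; exact E.
    + intros x. apply HR. auto.
    + intros x y. rewrite !HR. intros [E|[H _]] [E'|[H' _]]; try congruence.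
      destruct (lt_irrefl _ (lt_trans _ _ _ H H')).
    + intros x y z. rewrite !HR. intros [->|[H HxyS]] [<-|[H' HyzS]]; auto.
      right. split; [exact (lt_trans _ _ _ H H')|].
      (* If x and z shared an interval, y between them would belong to it too. *)
      intros Hxz. apply HxyS, (Hconv x y z); [left; exact H | left; exact H' | exact Hxz].
  - destruct (HS H HH) as [(x & y & Hx & Hy & Hxy & Hsame) (x' & y' & Hx' & Hy' & Hxy' & Hdiff)].
    destruct Hchain as [Hch|Hanti].
    + destruct (Hch x y Hx Hy) as [HRxy|HRyx].
      * apply HR in HRxy. destruct HRxy as [<-|[_ Hd]]; [exact (lt_irrefl _ Hxy) | tauto].
      * apply HR in HRyx. destruct HRyx as [<-|[Hyx _]]; [exact (lt_irrefl _ Hxy)|].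
        exact (lt_irrefl _ (lt_trans _ _ _ Hxy Hyx)).
    + destruct (Hanti x' y' Hx' Hy') as [Hd _].
      * intros <-. exact (lt_irrefl _ Hxy').
      * apply Hd, HR. auto.
Qed.

(* The order is reversed inside each interval, and the intervals keep
   their order. *)
Lemma l_ADS_st_ISigma01 : l_ADS_st M -> ISigma01 M.
Proof.
  intros HADS. apply NNPP. intros Hn.
  destruct (interval_equivalence Hn) as (S & Hrefl & Hsym & Htrans & Hconv & HS).
  destruct (relation_comprehension (fun x y =>
      (x < y /\ ~ pair M x y ∈ S) \/ (y <= x /\ pair M x y ∈ S)))
    as (R & HR & HRp).
  { d0. }
  destruct (HADS R) as (H & HH & Hmono).
  - split; [split; [|split; [|split]]|].
    + intros q Hq. destruct (HRp q Hq) as (x & y & E). exists x, y. repeat split; exact E.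
    + intros x. apply HR. right. split; [apply le_refl | apply Hrefl].
    + intros x y. rewrite !HR. intros [[H HxyS]|[H HxyS]] [[H' HyxS]|[H' HyxS]].
      * destruct (lt_irrefl _ (lt_trans _ _ _ H H')).
      * destruct (HxyS (Hsym _ _ HyxS)).
      * destruct (HyxS (Hsym _ _ HxyS)).
      * exact (le_antisymm _ _ H' H).
    + intros x y z. rewrite !HR. intros [[H HxyS]|[H HxyS]] [[H' HyzS]|[H' HyzS]].
      * left. split; [exact (lt_trans _ _ _ H H')|].
        intros Hxz. apply HxyS, (Hconv x y z); [left; exact H | left; exact H' | exact Hxz].
      (* Here z lies in the interval of y, beyond that of x. If z <= x, then x would lie between z
         and y, hence in their interval. The next case is symmetric. *)
      * left. split.
        -- destruct (lt_or_ge x z) as [Hlt|Hge]; [exact Hlt|]. destruct HxyS.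
           apply Htrans with z; [|exact (Hsym _ _ HyzS)].
           apply Hsym, (Hconv z x y); [exact Hge | left; exact H | exact (Hsym _ _ HyzS)].
        -- intros Hxz. apply HxyS, (Htrans x z y Hxz (Hsym _ _ HyzS)).
      * left. split.
        -- destruct (lt_or_ge x z) as [Hlt|Hge]; [exact Hlt|]. destruct HyzS.
           apply (Hconv y z x); [left; exact H' | exact Hge | exact (Hsym _ _ HxyS)].
        -- intros Hxz. apply HyzS, (Htrans y x z (Hsym _ _ HxyS) Hxz).
      * right. split; [exact (le_trans _ _ _ H' H) | exact (Htrans _ _ _ HxyS HyzS)].
    + intros x y. rewrite !HR.
      destruct (classic (pair M x y ∈ S)) as [H|H].
      * destruct (lt_or_ge x y) as [Hlt|Hge].
        -- right. right. split; [left; exact Hlt | exact (Hsym _ _ H)].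
        -- left. right. split; assumption.
      * destruct (lt_or_ge x y) as [Hlt|[Hlt|Heq]].
        -- left. left. split; assumption.
        -- right. left. split; [exact Hlt|]. intros H'. exact (H (Hsym _ _ H')).
        -- destruct H. rewrite Heq. apply Hrefl.
  - destruct (HS H HH) as [(x & y & Hx & Hy & Hxy & Hsame) (x' & y' & Hx' & Hy' & Hxy' & Hdiff)].
    destruct Hmono as [Hasc|Hdesc].
    (* Two elements in one interval refute agreement with the usual order; two in different
       intervals refute agreement with its reverse. *)
    + pose proof (proj1 (Hasc x y Hx Hy) (or_introl Hxy)) as HRxy.
      apply HR in HRxy. destruct HRxy as [[_ Hd]|[Hle _]]; [tauto|].
      exact (lt_not_le _ _ Hxy Hle).
    + pose proof (proj1 (Hdesc x' y' Hx' Hy') (or_introl Hxy')) as HRyx.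
      apply HR in HRyx. destruct HRyx as [[Hlt _]|[_ Hs]].
      * exact (lt_irrefl _ (lt_trans _ _ _ Hxy' Hlt)).
      * exact (Hdiff (Hsym _ _ Hs)).
Qed.

End Structure.

Theorem theorem4p2 :
  implies_over RCA0_star l_RT22 ISigma01 /\
  implies_over RCA0_star l_CAC ISigma01 /\
  implies_over RCA0_star l_ADS_st ISigma01.
Proof.
  split; [|split]; intros M (HB & HI & HC & HE);
    (* The value sequence witnessing 2^0 provides a set for [X0]. *)
    destruct (HE (zero M)) as (_ & X & _).
  - exact (l_RT22_ISigma01 M X HB HI HC HE).
  - exact (l_CAC_ISigma01 M X HB HI HC HE).
  - exact (l_ADS_st_ISigma01 M X HB HI HC HE).
Qed.
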